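(* Let $N=n^d$, $d\ge 1$, let $\mathbf{C}=\sum_{i=1}^{r}\bigotimes_{\mu=1}^d \mathbf{C}_{i\mu}\in\mathbb{R}^{N\times N}$ with $\mathbf{C}_{i\mu}\in\mathbb{R}^{n\times n}$, and let $\mathbf{z}\in\mathbb{R}^N$ be separable in the sense that $\big\Vert \mathbf{z}-\sum_{j=1}^{r_z}\bigotimes_{\nu=1}^d \mathbf{z}_{j\nu}\big\Vert\le\varepsilon$ with $\mathbf{z}_{j\nu}\in\mathbb{R}^n$. Then the computing cost of the product $\mathbf{C}\mathbf{z}$ is reduced from $\mathcal{O}(N^2)$ to $\mathcal{O}(r\,r_z\,d\,n^2)$.
   Context: $\bigotimes$ denotes the Kronecker (tensor) product of matrices or of vectors; $r$ and $r_z$ are the numbers of terms in the separable representations of $\mathbf{C}$ and $\mathbf{z}$; $n$ is the number of mesh points in each of the $d$ directions. The product to which the cost refers is written in the low-rank tensor format as $\mathbf{C}\mathbf{z}=\sum_{i=1}^{r}\sum_{j=1}^{r_z}\bigotimes_{\mu=1}^d \mathbf{C}_{i\mu}\mathbf{z}_{j\mu}$. *)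

(* Defs.v *)
From HB Require Import structures.
From mathcomp Require Import all_boot all_order all_algebra reals mxtens.

Set Implicit Arguments.
Unset Strict Implicit.
Unset Printing Implicit Defensive.

Import Order.TTheory GRing.Theory Num.Theory.
Local Open Scope ring_scope.

(* Straight-line arithmetic programs: the list of operations is fixed before
   the values of the inputs, and each arithmetic operation costs 1. *)

(* [Res k] is the result of the k-th operation, counted from 0. *)
Inductive operand (I : Type) : Type :=
| Inp of I
| Res of nat.
Arguments Res {I} k.

Inductive arith : Type := Add | Sub | Mul.

Record instr (I : Type) : Type := Instr {
  op : arith;
  lhs : operand I;
  rhs : operand I }.

Record slp (I O : Type) : Type := Slp {
  code : seq (instr I);
  out : O -> operand I }.

Definition cost (I O : Type) (p : slp I O) : nat := size (code p).

Section Semantics.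
Variables (R : pzRingType) (I O : Type).

(* An operation that is not yet computed reads as 0. *)
Definition read (x : I -> R) (mem : seq R) (a : operand I) : R :=
  match a with
  | Inp i => x i
  | Res k => nth 0 mem k
  end.

Definition arith_fun (o : arith) : R -> R -> R :=
  match o with
  | Add => fun a b => a + b
  | Sub => fun a b => a - b
  | Mul => fun a b => a * b
  end.

Definition step (x : I -> R) (mem : seq R) (c : instr I) : seq R :=
  rcons mem (arith_fun (op c) (read x mem (lhs c)) (read x mem (rhs c))).

Definition run (p : slp I O) (x : I -> R) (o : O) : R :=
  read x (foldl (step x) [::] (code p)) (out p o).

End Semantics.

Definition full_in (N : nat) : Type := ('I_N * 'I_N + 'I_N)%type.

Definition full_input (R : Type) (N : nat) (C : 'M[R]_N) (z : 'cV[R]_N)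
    (a : full_in N) : R :=
  match a with
  | inl (k, l) => C k l
  | inr l => z l ord0
  end.

(* Entries of the factors C_{i mu} (r * d matrices) and z_{j mu}
   (rz * d vectors). *)
Definition sep_in (d n r rz : nat) : Type :=
  ('I_r * 'I_d * ('I_n * 'I_n) + 'I_rz * 'I_d * 'I_n)%type.

(* Entries of r * rz * d vectors of length n: the factors of a separable
   representation with r * rz terms. *)
Definition sep_out (d n r rz : nat) : Type :=
  ('I_r * 'I_rz * 'I_d * 'I_n)%type.

Definition sep_input (R : Type) (d n r rz : nat)
    (Cf : 'I_r -> 'I_d -> 'M[R]_n) (zf : 'I_rz -> 'I_d -> 'cV[R]_n)
    (a : sep_in d n r rz) : R :=
  match a with
  | inl (i, mu, (k, l)) => Cf i mu k l
  | inr (j, mu, l) => zf j mu l ord0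
  end.

Fixpoint kron (R : pzRingType) (m n d : nat) :
    ('I_d -> 'M[R]_(m, n)) -> 'M[R]_(m ^ d, n ^ d) :=
  match d with
  | 0 => fun _ => const_mx 1
  | d'.+1 => fun A =>
      castmx (esym (expnS m d'), esym (expnS n d'))
        (A ord0 *t kron (fun mu => A (lift ord0 mu)))
  end.

(* For column vectors, [kron] has [1 ^ d] columns. *)
Definition kronv (R : pzRingType) (n d : nat) (v : 'I_d -> 'cV[R]_n) :
    'cV[R]_(n ^ d) :=
  castmx (erefl (n ^ d)%N, exp1n d) (kron v).

Record is_norm (R : numDomainType) (N : nat) (nu : 'cV[R]_N -> R) : Prop :=
  IsNorm {
    norm_eq0 : forall x, nu x = 0 -> x = 0;
    norm_triangle : forall x y, nu (x + y) <= nu x + nu y;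
    norm_scale : forall a x, nu (a *: x) = `|a| * nu x }.

(* Main.v *)
Require Import Defs.
From HB Require Import structures.
From mathcomp Require Import all_boot all_order all_algebra reals mxtens.

Set Implicit Arguments.
Unset Strict Implicit.
Unset Printing Implicit Defensive.

Import Order.TTheory GRing.Theory Num.Theory.
Local Open Scope ring_scope.

(** Two facts make the product of separable data cheap.

    The first is the mixed-product rule of the Kronecker product,
    (A *t B) *m (A' *t B') = (A *m A') *t (B *m B').  Iterated over the [d]
    directions it says that a Kronecker product of matrices is applied to a
    Kronecker product of vectors factor by factor ([kron_mulmx],
    [kronv_mulmx]).  By bilinearity, the image of the separable approximation
    of [z] under [C] is again separable, with [r * rz] terms, and all that
    has to be computed are the factors [Cf i mu *m zf j mu]: there are
    [r * rz * d] of these matrix-vector products in dimension [n].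

    The second is the cost of the schoolbook matrix-vector product.  Each
    entry is an inner product, and an inner product of length [m > 0] takes
    [m] multiplications and [m - 1] additions.  A single straight-line
    program that evaluates a finite family of inner products of one length
    ([inner_slp], with [cost_inner_slp] and [run_inner_slp]) therefore serves
    both sides of the comparison: [N] inner products of length [N] for the
    dense product, hence at most [2 * N ^ 2] operations, and [r * rz * d * n]
    inner products of length [n] for the separable one, hence at most
    [2 * (r * rz * d * n ^ 2)].

    The error bound is linearity: the difference between the exact and the
    separable product is [C] applied to the approximation error of [z]. *)

(** * Straight-line programs for families of inner products *)

Section InnerProductCode.
Variable I : Type.
Implicit Types (k : nat) (s : seq (I * I)) (ss : seq (seq (I * I))).

(** [k] is the number of results already in memory, and the running sum is
    always the last of them, [Res k.-1]: a product is appended, and then its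
    sum with the result just before it. *)
Fixpoint running_sum_code k s : seq (instr I) :=
  if s is (a, b) :: s' then
    [:: Instr Mul (Inp a) (Inp b), Instr Add (Res k.-1) (Res k)
      & running_sum_code k.+2 s']
  else [::].

Definition inner_code k s : seq (instr I) :=
  if s is (a, b) :: s' then
    Instr Mul (Inp a) (Inp b) :: running_sum_code k.+1 s'
  else [::].

Fixpoint inners_code k ss : seq (instr I) :=
  if ss is s :: ss' then
    inner_code k s ++ inners_code (k + size (inner_code k s)) ss'
  else [::].

Lemma size_running_sum_code k s : size (running_sum_code k s) = (size s).*2.
Proof. by elim: s k => [|[a b] s IHs] k //=; rewrite IHs. Qed.

Lemma size_inner_code k s : size (inner_code k s) = (size s).*2.-1.
Proof. by case: s => [|[a b] s] //=; rewrite size_running_sum_code. Qed.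

Lemma size_inners_code m k ss :
  all (fun s => size s == m) ss ->
  size (inners_code k ss) = (size ss * m.*2.-1)%N.
Proof.
elim: ss k => [|s ss IHss] k //= /andP[/eqP sz_s /IHss sz_ss].
by rewrite size_cat sz_ss size_inner_code sz_s mulSn.
Qed.

Section Run.
Variables (R : pzRingType) (x : I -> R).
Implicit Types (mem : seq R).

Lemma size_foldl_step mem c : size (foldl (step x) mem c) = (size mem + size c)%N.
Proof.
elim: c mem => [|i c IHc] mem /=; first by rewrite addn0.
by rewrite IHc size_rcons addSnnS.
Qed.

(** Results are only ever appended, so later blocks of code do not disturb
    what earlier ones computed. *)
Lemma nth_foldl_step mem c k :
  (k < size mem)%N -> nth 0 (foldl (step x) mem c) k = nth 0 mem k.
Proof.
elim: c mem => [|i c IHc] mem //= lt_k.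
by rewrite IHc ?nth_rcons ?lt_k // size_rcons leqW.
Qed.

Lemma last_running_sum_code mem u s :
  last 0 (foldl (step x) (rcons mem u) (running_sum_code (size mem).+1 s)) =
  u + \sum_(ab <- s) x ab.1 * x ab.2.
Proof.
elim: s mem u => [|[a b] s IHs] mem u /=.
  by rewrite big_nil addr0 last_rcons.
rewrite big_cons /= addrA.
set p := x a * x b; rewrite -(IHs (rcons (rcons mem u) p)) !size_rcons.
congr (last _ (foldl _ _ _)); rewrite {1}/step /=; congr rcons.
by rewrite /step /= !nth_rcons !size_rcons !ltnn !ltnS leqnn !eqxx.
Qed.

Lemma last_inner_code mem s :
  (0 < size s)%N ->
  last 0 (foldl (step x) mem (inner_code (size mem) s)) =
  \sum_(ab <- s) x ab.1 * x ab.2.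
Proof.
by case: s => [|[a b] s] //= _; rewrite last_running_sum_code big_cons.
Qed.

(** With rows of equal length [m], the blocks of code have equal length
    [m.*2.-1], and the inner product of row [i] is the last result of
    block [i]. *)
Lemma nth_inners_code m mem ss i :
  (0 < m)%N -> all (fun s => size s == m) ss -> (i < size ss)%N ->
  nth 0 (foldl (step x) mem (inners_code (size mem) ss))
    (size mem + i.+1 * m.*2.-1).-1 =
  \sum_(ab <- nth [::] ss i) x ab.1 * x ab.2.
Proof.
move=> m_gt0.
have len_gt0 : (0 < m.*2.-1)%N by case: (m) m_gt0.
elim: ss mem i => [|s ss IHss] mem i //= /andP[/eqP sz_s sz_ss] lt_i.
rewrite foldl_cat; set mem1 := foldl _ mem _.
have sz_mem1 : size mem1 = (size mem + m.*2.-1)%N.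
  by rewrite size_foldl_step size_inner_code sz_s.
rewrite size_inner_code sz_s -sz_mem1.
case: i lt_i => [|i] lt_i /=; last first.
  by rewrite mulSn addnA -sz_mem1 IHss.
rewrite mul1n -sz_mem1 nth_foldl_step ?prednK ?sz_mem1 ?addn_gt0 ?len_gt0 ?orbT //.
by rewrite -sz_mem1 nth_last last_inner_code // sz_s.
Qed.

End Run.
End InnerProductCode.

Section InnerProductProgram.
Variables (I : Type) (T : finType) (m : nat) (a b : T -> 'I_m -> I).

Definition inner_rows : seq (seq (I * I)) :=
  [seq [seq (a t l, b t l) | l <- enum 'I_m] | t <- enum T].

Definition inner_slp : slp I T :=
  Slp (inners_code 0 inner_rows)
      (fun t => Res ((enum_rank t).+1 * m.*2.-1).-1).

Lemma all_size_inner_rows : all (fun s => size s == m) inner_rows.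
Proof. by rewrite all_map; apply/allP => t _ /=; rewrite size_map size_enum_ord. Qed.

Lemma cost_inner_slp : (cost inner_slp <= 2 * (#|T| * m))%N.
Proof.
rewrite /cost (size_inners_code _ all_size_inner_rows) size_map -cardE.
by rewrite mulnCA leq_mul // mul2n leq_pred.
Qed.

(** An empty block of code leaves no result to read its value from, which is
    why [m] has to be positive. *)
Lemma run_inner_slp (R : pzRingType) (x : I -> R) t :
  (0 < m)%N -> run inner_slp x t = \sum_(l < m) x (a t l) * x (b t l).
Proof.
move=> m_gt0; rewrite /run /=.
have lt_t : (enum_rank t < size (enum T))%N by rewrite -cardE.
have lt_row : (enum_rank t < size inner_rows)%N by rewrite size_map.
(* Execution starts from the empty memory, hence the offset [size [::]]. *)
rewrite -[X in nth _ _ X.-1]/(size (Nil R) + _)%N.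
rewrite (nth_inners_code x [::] m_gt0 all_size_inner_rows lt_row).
by rewrite (nth_map t) // nth_enum_rank big_map big_enum.
Qed.

End InnerProductProgram.

(** * The mixed-product rule for iterated Kronecker products *)

Lemma castmx_mulmx (R : pzRingType) m m' n n' p p' (eq_m : m = m')
    (eq_n : n = n') (eq_p : p = p') (A : 'M[R]_(m, n)) (B : 'M[R]_(n, p)) :
  castmx (eq_m, eq_p) (A *m B) =
  castmx (eq_m, eq_n) A *m castmx (eq_n, eq_p) B.
Proof. by case: m' / eq_m; case: n' / eq_n; case: p' / eq_p. Qed.

Section MixedProduct.
Variable R : comPzRingType.

Lemma kron_mulmx m n p d (A : 'I_d -> 'M[R]_(m, n)) (B : 'I_d -> 'M[R]_(n, p)) :
  kron (fun mu => A mu *m B mu) = kron A *m kron B.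
Proof.
elim: d A B => [|d IHd] A B /=.
  by apply/matrixP => i j; rewrite !mxE big_ord1 !mxE mulr1.
by rewrite IHd -tensmx_mul -castmx_mulmx.
Qed.

Lemma kronv_mulmx n d (A : 'I_d -> 'M[R]_n) (v : 'I_d -> 'cV[R]_n) :
  kronv (fun mu => A mu *m v mu) = kron A *m kronv v.
Proof.
by rewrite /kronv kron_mulmx (castmx_mulmx _ (erefl (n ^ d)%N)) castmx_id.
Qed.

End MixedProduct.

Lemma eq_kron (R : pzRingType) m n d (A B : 'I_d -> 'M[R]_(m, n)) :
  A =1 B -> kron A = kron B.
Proof.
elim: d A B => [|d IHd] A B eqAB //=.
by rewrite eqAB (IHd _ (fun mu => B (lift ord0 mu))).
Qed.

(** * Cost of the dense and of the separable product *)

Definition full_slp (N : nat) : slp (full_in N) 'I_N :=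
  inner_slp (fun k l => inl (k, l)) (fun _ l => inr l).

Definition sep_slp (d n r rz : nat) : slp (sep_in d n r rz) (sep_out d n r rz) :=
  @inner_slp (sep_in d n r rz) ('I_r * 'I_rz * 'I_d * 'I_n)%type n
    (fun t l => let: (i, _, mu, k) := t in inl (i, mu, (k, l)))
    (fun t l => let: (_, j, mu, _) := t in inr (j, mu, l)).

Theorem lemma4p1 (R : realType) :
  exists K1 K2 : nat, forall d n r rz : nat, (1 <= d)%N ->
  let N := (n ^ d)%N in
  exists (full : slp (full_in N) 'I_N)
         (sep : slp (sep_in d n r rz) (sep_out d n r rz)),
  [/\ (cost full <= K1 * N ^ 2)%N,
      forall (C : 'M[R]_N) (z : 'cV[R]_N),
        \col_k run full (full_input C z) k = C *m z,
      (cost sep <= K2 * (r * rz * d * n ^ 2))%N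
    & forall (Cf : 'I_r -> 'I_d -> 'M[R]_n) (C : 'M[R]_N)
             (zf : 'I_rz -> 'I_d -> 'cV[R]_n) (z : 'cV[R]_N)
             (nu : 'cV[R]_N -> R) (eps : R),
        C = \sum_(i < r) kron (Cf i) ->
        is_norm nu ->
        nu (z - \sum_(j < rz) kronv (zf j)) <= eps ->
        let w (i : 'I_r) (j : 'I_rz) (mu : 'I_d) : 'cV[R]_n :=
          \col_k run sep (sep_input Cf zf) (i, j, mu, k) in
        let Cz := \sum_(i < r) \sum_(j < rz) kronv (w i j) in
        [/\ forall i j mu, w i j mu = Cf i mu *m zf j mu,
            Cz = C *m (\sum_(j < rz) kronv (zf j))
          & forall L : R, 0 <= L -> (forall x, nu (C *m x) <= L * nu x) ->
              nu (C *m z - Cz) <= L * eps]].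
Proof.
exists 2, 2 => d n r rz _ N; exists (full_slp N), (sep_slp d n r rz); split.
- by rewrite (leq_trans (cost_inner_slp _ _)) // card_ord.
- move=> C z; apply/matrixP => k j; rewrite !mxE ord1.
  (* An index below [N] forces [N > 0], so the inner products are nonempty. *)
  by rewrite run_inner_slp // (leq_ltn_trans _ (ltn_ord k)).
- rewrite (leq_trans (cost_inner_slp _ _)) // !card_prod !card_ord.
  by rewrite -mulnA mulnn.
move=> Cf C zf z nu eps defC _ le_eps w Cz.
have wE i j mu : w i j mu = Cf i mu *m zf j mu.
  apply/matrixP => k l; rewrite !mxE ord1.
  by rewrite run_inner_slp // (leq_ltn_trans _ (ltn_ord k)).
have CzE : Cz = C *m (\sum_(j < rz) kronv (zf j)).
  rewrite defC mulmx_suml; apply: eq_bigr => i _.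
  rewrite mulmx_sumr; apply: eq_bigr => j _.
  by rewrite -kronv_mulmx /kronv (eq_kron (wE i j)).
split=> // L L_ge0 boundC.
by rewrite CzE -mulmxBr (le_trans (boundC _)) // ler_wpM2l.
Qed.
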